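(* Let $t\geq s \geq 2$ be integers. Then $$c(K_{s,t}) \leq 40 \left(\sqrt{st \log s}+s+t\right).$$
   Context: All graphs are finite and simple. $K_{s,t}$ is the complete bipartite graph with parts of sizes $s$ and $t$. A graph $H$ is a minor of $G$ if a graph isomorphic to $H$ can be obtained from a subgraph of $G$ by contracting edges. For a non-null graph $G$, $d(G)=e(G)/v(G)$. For a graph $H$ with $v(H)\ge 2$, $c(H)$ is the supremum of $d(G)$ over all non-null graphs $G$ not containing $H$ as a minor. $\log$ is the natural logarithm. *)

(* Defs.v *)
From mathcomp Require Import all_boot all_order all_algebra.
From mathcomp Require Import classical_sets reals constructive_ereal ereal exp.

Set Implicit Arguments.
Unset Strict Implicit.
Unset Printing Implicit Defensive.

Import Order.TTheory GRing.Theory Num.Theory.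

Local Open Scope ring_scope.

Record sgraph := SGraph {
  vertex :> finType;
  edge : rel vertex;
  edge_sym : symmetric edge;
  edge_irrefl : irreflexive edge }.

Definition edges (G : sgraph) : {set {set G}} :=
  [set [set p.1; p.2]%SET | p in [set p : G * G | edge p.1 p.2]%SET]%SET.

Definition density (R : realType) (G : sgraph) : R := #|edges G|%:R / #|G|%:R.

Definition isomorphic (G H : sgraph) : Prop :=
  exists2 f : G -> H, bijective f & forall x y, edge (f x) (f y) = edge x y.

(* [H] is isomorphic to a (not necessarily induced) subgraph of [G]. *)
Definition subgraph (H G : sgraph) : Prop :=
  exists2 f : H -> G, injective f & forall x y, edge x y -> edge (f x) (f y).

Section Contraction.
Variables (G : sgraph) (x y : G).

(* Contracting the edge xy: y is deleted and x inherits its neighbours. *)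
Definition contract_edge : rel {z : G | z != y} := fun a b =>
  (a != b) && [|| edge (val a) (val b),
                  (val a == x) && edge y (val b) |
                  (val b == x) && edge (val a) y].

Lemma contract_edge_sym : symmetric contract_edge.
Proof.
move=> a b; rewrite /contract_edge eq_sym; congr andb.
rewrite (edge_sym (val a) (val b)) (edge_sym y (val b)) (edge_sym (val a) y).
by congr orb; rewrite orbC.
Qed.

Lemma contract_edge_irrefl : irreflexive contract_edge.
Proof. by move=> a; rewrite /contract_edge eqxx. Qed.

Definition contract : sgraph := SGraph contract_edge_sym contract_edge_irrefl.

End Contraction.

Inductive contracts_to : sgraph -> sgraph -> Prop :=
| contracts_refl G : contracts_to G G
| contracts_step (G : sgraph) (x y : G) K :
    edge x y -> contracts_to (contract x y) K -> contracts_to G K.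

Definition minor (H G : sgraph) : Prop :=
  exists G' K, [/\ subgraph G' G, contracts_to G' K & isomorphic K H].

(* The supremum is taken in the extended reals: the real-valued [sup] would be
   0 on an unbounded set. *)
Definition extremal_density (R : realType) (H : sgraph) : \bar R :=
  ereal_sup
    [set d : \bar R | exists G : sgraph,
       [/\ (0 < #|G|)%N, ~ minor H G & d = (density R G)%:E]]%classic.

Section CompleteBipartite.
Variables s t : nat.

Definition Kst_edge : rel ('I_s + 'I_t)%type := fun u v =>
  match u, v with
  | inl _, inr _ | inr _, inl _ => true
  | _, _ => false
  end.

Lemma Kst_edge_sym : symmetric Kst_edge.
Proof. by case=> ? [] ?. Qed.

Lemma Kst_edge_irrefl : irreflexive Kst_edge.
Proof. by case. Qed.

Definition Kst : sgraph := SGraph Kst_edge_sym Kst_edge_irrefl.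

End CompleteBipartite.

(* Main.v *)
(* Let [X = sqrt (s t log s) + s + t], and let G have more than [40 X |G|]
   edges. A minor of G that is minimal with this edge density has a vertex of
   degree at most [80 X + 2], whose neighbourhood induces a graph of minimum
   degree more than [40 X - 1]. Repeating the argument in this dense graph
   with Mader's superlinear edge bound [k n (1 + log (n / k)) / 2], for
   [k = 11 X], yields a minor with N vertices in which any two vertices have
   more than [k - 5] common neighbours.

   In such a graph K_{s,t} is found greedily. As long as the vertices used so
   far leave two vertices with a free common neighbour, every vertex misses at
   most half of the free vertices, so some free vertex is adjacent to at least
   half of any given set of targets. Adding such vertices one at a time, each
   joined by a common neighbour to a root, produces a connected set of at most
   [2 a + 1] free vertices with at most [2 ^ -a] as many missed vertices as
   its root. Once [2 t] such sets are chosen, the same procedure, with these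
   sets as the targets, produces the [s] branch sets on the other side. *)
Require Import Defs.
From mathcomp Require Import all_boot all_order all_algebra.
From mathcomp Require Import classical_sets reals constructive_ereal ereal exp.
From mathcomp Require Import sequences zify ring lra.

Set Implicit Arguments.
Unset Strict Implicit.
Unset Printing Implicit Defensive.

Import Order.TTheory GRing.Theory Num.Theory.
From mathcomp Require Import fintype finset.

Local Open Scope nat_scope.

(** * Edge counts under minor operations and branch sets *)

Section Counting.
Variable T : finType.
Implicit Types (V X W : {set T}) (r : rel T).

Definition nbhd V r x : {set T} := [set u in V | r x u]%SET.

(** Graphs are encoded as a vertex subset [V] of a fixed type with a relation [r], so that minor
    operations never change the type. For symmetric irreflexive [r] this is twice the number of
    edges induced on [V]. *)
Definition degsum V r := \sum_(x in V) #|nbhd V r x|.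

(** Here [y] is only merged into [x]; its removal is expressed separately by passing to [V :\ y]. *)
Definition contr r x y : rel T := fun a b =>
  (a != b) && [|| r a b, (a == x) && r y b | (b == x) && r a y].

Definition del r x y : rel T := fun a b =>
  r a b && ~~ ((a == x) && (b == y) || (a == y) && (b == x)).

Lemma contr_sym r x y : symmetric r -> symmetric (contr r x y).
Proof.
move=> rS a b; rewrite /contr eq_sym; congr andb.
by rewrite (rS a b) (rS y b) (rS a y); congr orb; rewrite orbC.
Qed.

Lemma contr_irr r x y : irreflexive (contr r x y).
Proof. by move=> a; rewrite /contr eqxx. Qed.

Lemma del_sym r x y : symmetric r -> symmetric (del r x y).
Proof. by move=> rS a b; rewrite /del rS orbC ![_ && (b == _)]andbC. Qed.

Lemma del_irr r x y : irreflexive r -> irreflexive (del r x y).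
Proof. by move=> rI a; rewrite /del rI. Qed.

Lemma eq_degsum V r r' :
  {in V &, forall a b, r a b = r' a b} -> degsum V r = degsum V r'.
Proof.
move=> e; apply: eq_bigr => x xV; apply: eq_card => u; rewrite !inE.
by case uV: (u \in V) => //=; rewrite e.
Qed.

Lemma degsum_del V r y : symmetric r -> irreflexive r -> y \in V ->
  degsum V r = degsum (V :\ y) r + (#|nbhd V r y|).*2.
Proof.
move=> rS rI yV; rewrite /degsum (big_setD1 y) //=.
have -> : \sum_(x in V :\ y) #|nbhd V r x| =
          \sum_(x in V :\ y) (r x y + #|nbhd (V :\ y) r x|).
  apply: eq_bigr => x _; rewrite (cardsD1 y) !inE yV /=; congr (_ + _).
  by apply: eq_card => u; rewrite !inE andbA.
rewrite big_split /=.
have -> : \sum_(x in V :\ y) r x y = #|nbhd V r y|.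
  rewrite -sum1_card big_mkcond [RHS]big_mkcond; apply: eq_bigr => x _.
  rewrite !inE (rS y x); case: eqVneq => [->|_] /=; first by rewrite rI andbF.
  by case: (x \in V) => //=; case: (r x y).
by rewrite -addnn; lia.
Qed.

Lemma degsum_le V r : irreflexive r -> degsum V r <= #|V| * #|V|.-1.
Proof.
move=> rI; rewrite -sum_nat_const; apply: leq_sum => x xV.
rewrite (cardsD1 x V) xV /=; apply/subset_leq_card/subsetP => u.
by rewrite !inE => /andP[-> rxu]; rewrite andbT; apply: contraTneq rxu => ->; rewrite rI.
Qed.

(** The contracted edge disappears, and for each common neighbour of [x] and [y] two edges become
    one; each lost edge counts twice. *)
Lemma degsum_contr V r x y : symmetric r -> irreflexive r ->
    x \in V -> y \in V -> r x y ->
  degsum V r = degsum (V :\ y) (contr r x y) + 2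
               + (#|nbhd V r x :&: nbhd V r y|).*2.
Proof.
move=> rS rI xV yV rxy.
have xy : x != y by apply: contraTneq rxy => ->; rewrite rI.
have xVy : x \in V :\ y by rewrite !inE xy.
rewrite (degsum_del rS rI yV) (degsum_del rS rI xVy).
rewrite (degsum_del (contr_sym x y rS) (@contr_irr r x y) xVy).
have -> : degsum (V :\ y :\ x) (contr r x y) = degsum (V :\ y :\ x) r.
  apply: eq_degsum => a b; rewrite !inE => /and3P[ax _ _] /and3P[bx _ _].
  rewrite /contr (negbTE ax) (negbTE bx) /= !orbF.
  by case: eqVneq => [->|//]; rewrite rI.
have e1 : #|nbhd V r x| = (#|nbhd (V :\ y) r x|).+1.
  rewrite (cardsD1 y) !inE yV rxy add1n; congr _.+1.
  by apply: eq_card => u; rewrite !inE andbA.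
have e2 : #|nbhd V r y| = (#|nbhd V r y :\ x|).+1.
  by rewrite (cardsD1 x) !inE xV rS rxy add1n.
have -> : nbhd (V :\ y) (contr r x y) x = nbhd (V :\ y) r x :|: (nbhd V r y :\ x).
  apply/setP => u; rewrite !inE /contr eqxx /=.
  rewrite [x == u]eq_sym; case: (eqVneq u x) => [->|ux] /=.
    by rewrite rI !andbF.
  case: (eqVneq u y) => [->|uy] /=; first by rewrite rI andbF.
  by rewrite orbF; case: (u \in V).
have := cardsUI (nbhd (V :\ y) r x) (nbhd V r y :\ x).
have -> : nbhd (V :\ y) r x :&: (nbhd V r y :\ x) = nbhd V r x :&: nbhd V r y.
  apply/setP => u; rewrite !inE.
  case: (eqVneq u x) => [->|ux] /=; first by rewrite rI !andbF.
  by case: (eqVneq u y) => [->|uy] //=; rewrite rI !andbF.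
lia.
Qed.

Lemma degsum_del_edge V r x y : symmetric r -> irreflexive r ->
    x \in V -> y \in V -> r x y ->
  degsum V r = degsum V (del r x y) + 2.
Proof.
move=> rS rI xV yV rxy.
have xy : x != y by apply: contraTneq rxy => ->; rewrite rI.
rewrite (degsum_del rS rI xV) (degsum_del (del_sym x y rS) (del_irr x y rI) xV).
have -> : degsum (V :\ x) (del r x y) = degsum (V :\ x) r.
  apply: eq_degsum => a b; rewrite !inE => /andP[ax _] /andP[bx _].
  by rewrite /del (negbTE ax) (negbTE bx) /= andbF andbT.
have -> : #|nbhd V r x| = (#|nbhd V (del r x y) x|).+1.
  rewrite (cardsD1 y) !inE yV rxy add1n; congr _.+1.
  apply: eq_card => u; rewrite !inE /del eqxx (negbTE xy) /= orbF.
  by case: (u \in V); rewrite ?andbF //= andbC.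
lia.
Qed.

Lemma exists_min_deg V r : 0 < #|V| ->
  exists2 x, x \in V & #|nbhd V r x| * #|V| <= degsum V r.
Proof.
case/card_gt0P => x0 x0V.
case: (arg_minnP (fun x => #|nbhd V r x|) x0V) => x xV xmin.
by exists x => //; rewrite mulnC -sum_nat_const; apply: leq_sum => z; apply: xmin.
Qed.

End Counting.

(** * Minor models given by branch sets *)

Section Models.
Variables (T : finType) (H : sgraph).
Implicit Types (V X W : {set T}) (r : rel T).

Definition fiber_rel r (phi : T -> option H) h : rel T := fun a b =>
  [&& phi a == Some h, phi b == Some h & r a b].

(* The branch set of [h] is the fiber of [phi] over [Some h]. *)
Definition has_model V r := exists phi : T -> option H,
  [/\ forall z, phi z -> z \in V,
      forall h, exists z, phi z = Some h,
      forall h x y, phi x = Some h -> phi y = Some h ->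
        connect (fiber_rel r phi h) x y
    & forall h k : H, edge h k ->
        exists x y, [/\ phi x = Some h, phi y = Some k & r x y]].

Lemma has_model_sub V V' r r' : V' \subset V -> subrel r' r ->
  has_model V' r' -> has_model V r.
Proof.
move=> sV sr [phi [pV pS pC pE]]; exists phi; split => //.
- by move=> z /pV /(subsetP sV).
- move=> h x y px py; apply: connect_sub (pC h x y px py) => a b.
  by case/and3P => pa pb /sr rab; apply: connect1; rewrite /fiber_rel pa pb.
- by move=> h k /pE[x [y [px py /sr rxy]]]; exists x, y.
Qed.

(** The vertex [y] joins the branch set of [x], if there is one. An edge that [x] inherited from [y]
    is then rerouted through [y]. *)
Lemma has_model_contr V r x y : symmetric r -> y \in V -> r x y ->
  has_model (V :\ y) (contr r x y) -> has_model V r.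
Proof.
move=> rS yV rxy [phi [pV pS pC pE]].
have py z : phi z -> z != y by move/pV; rewrite !inE => /andP[].
pose psi z := if z == y then phi x else phi z.
have psiE z : phi z -> psi z = phi z by move/py/negbTE; rewrite /psi => ->.
have psiy : psi y = phi x by rewrite /psi eqxx.
have xy h : phi x = Some h -> fiber_rel r psi h x y.
  by move=> px; rewrite /fiber_rel psiy psiE px // eqxx.
have step h a b : fiber_rel (contr r x y) phi h a b ->
    connect (fiber_rel r psi h) a b.
  case/and3P => /eqP pa /eqP pb /andP[_].
  have sa : psi a = Some h by rewrite psiE pa.
  have sb : psi b = Some h by rewrite psiE pb.
  case/or3P => [rab|/andP[/eqP ax ryb]|/andP[/eqP bx ray]].
  - by apply: connect1; rewrite /fiber_rel sa sb eqxx.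
  - rewrite ax in pa *; apply: (connect_trans (connect1 (xy h pa))).
    by apply: connect1; rewrite /fiber_rel psiy pa sb eqxx.
  - rewrite bx in pb *; apply: (@connect_trans _ _ y); apply: connect1.
      by rewrite /fiber_rel sa psiy pb eqxx.
    by rewrite /fiber_rel psiy psiE pb // eqxx rS.
have fS h : symmetric (fiber_rel r psi h).
  by move=> a b; rewrite /fiber_rel rS andbCA.
have old h a : psi a = Some h ->
    exists2 b, phi b = Some h & connect (fiber_rel r psi h) a b.
  rewrite {1}/psi; case: eqVneq => [-> px|_ pa]; last by exists a.
  exists x => //; rewrite (sym_connect_sym (fS h)).
  exact/connect1/xy.
exists psi; split.
- move=> z; rewrite /psi; case: eqVneq => [-> //|_ /pV].
  by rewrite !inE => /andP[].
- by move=> h; have [z pz] := pS h; exists z; rewrite psiE pz.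
- move=> h a b /old[a' pa' ca] /old[b' pb' cb].
  apply: connect_trans ca _; rewrite (sym_connect_sym (fS h)).
  apply: connect_trans cb _; rewrite (sym_connect_sym (fS h)).
  by apply: connect_sub (pC h a' b' pa' pb') => c d /step.
- move=> h k /pE[a [b [pa pb /andP[_]]]].
  case/or3P => [rab|/andP[/eqP ax ryb]|/andP[/eqP bx ray]].
  + by exists a, b; rewrite !psiE ?pa ?pb.
  + by exists y, b; rewrite psiy -ax psiE pb.
  + by exists a, y; rewrite psiy -bx psiE pa.
Qed.

Lemma has_model_sets V r (X : H -> {set T}) :
    (forall h, X h \subset V) -> (forall h, 0 < #|X h|) ->
    (forall h k, h != k -> [disjoint X h & X k]) ->
    (forall h, {in X h &, forall x y,
       connect (fun a b => [&& a \in X h, b \in X h & r a b]) x y}) ->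
    (forall h k : H, edge h k -> exists x y, [/\ x \in X h, y \in X k & r x y]) ->
  has_model V r.
Proof.
move=> XV X0 XD XC XE.
pose phi z := [pick h | z \in X h].
have phiE z h : (phi z == Some h) = (z \in X h).
  rewrite /phi; case: pickP => [k zk|-> //].
  apply/eqP/idP => [[<-] //|zh]; congr Some; apply/eqP; apply: contraTT zh => kh.
  by move/pred0P: (XD _ _ kh) => /(_ z) /=; rewrite zk /= => ->.
exists phi; split.
- move=> z; case E : (phi z) => [h|//] _.
  by move/eqP: E; rewrite phiE; apply/subsetP.
- by move=> h; have /card_gt0P[z zh] := X0 h; exists z; apply/eqP; rewrite phiE.
- move=> h x y /eqP; rewrite phiE => xh /eqP; rewrite phiE => yh.
  apply: connect_sub (XC h x y xh yh) => a b abX.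
  by apply: connect1; rewrite /fiber_rel !phiE.
- move=> h k /XE[x [y [xh yk rxy]]]; exists x, y.
  by split => //; apply/eqP; rewrite phiE.
Qed.

End Models.

(** * Greedy branch sets in a dense graph *)

Section Dense.
Variable T : finType.
Implicit Types (V X Y W : {set T}) (r : rel T).

Definition misses V r x : {set T} := [set u in V | ~~ r x u]%SET.

(** Double counting of the pairs that are not hit. The relation [h] is abstract because the targets
    are first vertices and later branch sets. *)
Lemma exists_hitting (S : finType) (h : T -> S -> bool) (U : {set T})
    (W : {set S}) Q : 0 < #|U| ->
    {in W, forall w, Q * #|[set u in U | ~~ h u w]%SET| <= #|U|} ->
  exists2 u, u \in U & Q * #|[set w in W | ~~ h u w]%SET| <= #|W|.
Proof.
move=> U0 hW; have /card_gt0P[u0 u0U] := U0.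
pose f u := #|[set w in W | ~~ h u w]%SET|.
case: (arg_minnP f u0U) => u uU umin; exists u => //.
rewrite -(leq_pmul2r U0) -mulnA.
have le1 : f u * #|U| <= \sum_(v in U) f v.
  by rewrite mulnC -sum_nat_const; apply: leq_sum.
apply: leq_trans (leq_mul (leqnn Q) le1) _.
have -> : \sum_(v in U) f v = \sum_(w in W) #|[set u in U | ~~ h u w]%SET|.
  have cE (A : finType) (D : {set A}) (p : pred A) :
      #|[set z in D | p z]%SET| = \sum_(z in D) p z.
    rewrite -sum1_card big_mkcond [RHS]big_mkcond; apply: eq_bigr => z _.
    by rewrite !inE; case: (z \in D) => //=; case: (p z).
  rewrite (eq_bigr (fun v => \sum_(w in W) ~~ h v w)) => [|v _]; last exact: cE.
  by rewrite exchange_big; apply: eq_bigr => w _; rewrite cE.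
by rewrite big_distrr -sum_nat_const; apply: leq_sum.
Qed.

Definition within r X : rel T := fun a b => [&& a \in X, b \in X & r a b].

Lemma within_sym r X : symmetric r -> symmetric (within r X).
Proof. by move=> rS a b; rewrite /within rS andbCA. Qed.

Lemma connect_within_sub r X Y x y : X \subset Y ->
  connect (within r X) x y -> connect (within r Y) x y.
Proof.
move/subsetP => sXY; apply: connect_sub => a b /and3P[aX bX rab].
by apply: connect1; rewrite /within !sXY.
Qed.

Definition unhit (S : finType) (h : T -> S -> bool) (S0 : {set S}) X : {set S} :=
  [set w in S0 | [forall u in X, ~~ h u w]]%SET.

(** Each round adds a vertex hitting all but a share [1 / Q] of the targets still unhit, and a
    common neighbour linking it to the root [v0]: at most two new vertices per round. *)
Lemma grow_hitting (S : finType) (h : T -> S -> bool) (S0 : {set S})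
    V r W m Q v0 i :
    symmetric r -> {in V, forall y, #|misses V r y| <= m} ->
    #|W| + m.*2 < #|V| -> v0 \in V :\: W ->
    {in S0, forall w, Q * #|[set u in V :\: W | ~~ h u w]%SET| <= #|V :\: W|} ->
  exists X, [/\ v0 \in X, X \subset V :\: W, #|X| <= i.*2.+1,
    {in X, forall x, connect (within r X) v0 x}
    & #|unhit h S0 X| * Q ^ i <= #|unhit h S0 [set v0]|].
Proof.
move=> rS rm Wm v0U hit.
have cU : m.*2 < #|V :\: W|.
  by rewrite cardsD; have := subset_leq_card (subsetIr V W); lia.
elim: i => [|i [X [v0X XU cX conX hX]]].
  exists [set v0]; split; rewrite ?set11 ?sub1set ?cards1 ?muln1 //.
  by move=> x; rewrite inE => /eqP ->; apply: connect0.
have [||v vU hv] := @exists_hitting S h (V :\: W) (unhit h S0 X) Q; first by lia.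
  by move=> w; rewrite inE => /andP[wS _]; apply: hit.
have UV u : u \in V :\: W -> u \in V by rewrite inE => /andP[].
(* [v] and [v0] together miss at most [2 * m] vertices, fewer than are free. *)
have [c /and3P[cin rvc rv0c]] : exists c, [&& c \in V :\: W, r v c & r v0 c].
  have : 0 < #|(V :\: W) :\: (misses V r v :|: misses V r v0)|.
    rewrite cardsD; have := rm _ (UV _ vU); have := rm _ (UV _ v0U).
    have := subset_leq_card (subsetIr (V :\: W) (misses V r v :|: misses V r v0)).
    have := cardsUI (misses V r v) (misses V r v0); lia.
  case/card_gt0P => c; rewrite !inE negb_or => /andP[+ /andP[cW cV]].
  by rewrite cV /= !negbK => /andP[rvc rv0c]; exists c; rewrite !inE cW cV rvc rv0c.
have sX : X \subset c |: (v |: X) by rewrite setUA subsetUr.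
exists (c |: (v |: X)); split.
- exact: (subsetP sX).
- by rewrite !subUset !sub1set cin vU XU.
- rewrite !cardsU1; move: (c \notin _) (v \notin _) cX => c1 c2.
  by case: c1; case: c2; move: #|X| => k; rewrite doubleS; lia.
- have c0 : connect (within r (c |: (v |: X))) v0 c.
    by apply: connect1; rewrite /within rv0c !inE eqxx v0X !orbT.
  move=> x; rewrite !inE => /or3P[/eqP -> //|/eqP ->|xX].
    apply: connect_trans c0 _; apply: connect1.
    by rewrite /within rS rvc !inE !eqxx !orbT.
  exact: connect_within_sub sX (conX x xX).
- rewrite expnS mulnA; apply: leq_trans hX; rewrite leq_mul2r; apply/orP; right.
  rewrite mulnC; apply: leq_trans hv; rewrite leq_mul2l; apply/orP; right.
  apply: subset_leq_card; apply/subsetP => w; rewrite !inE => /andP[-> /forall_inP hw].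
  apply/andP; split; last by apply: hw; rewrite !inE eqxx orbT.
  by apply/forall_inP => u uX; apply: hw; rewrite !inE uX !orbT.
Qed.

(** Greedy choice: [w] is the budget of vertices that may be used up. The used set [W] is returned
    so that a second packing can start from it and avoid the first. *)
Lemma disjoint_packing V (P : {set T} -> Prop) c N W0 w :
    (forall W, #|W| + c <= w ->
       exists X, [/\ X \subset V :\: W, #|X| <= c & P X]) ->
    #|W0| + N * c <= w ->
  exists (A : nat -> {set T}) W,
    [/\ #|W| <= #|W0| + N * c, W0 \subset W,
        forall j, j < N -> [/\ A j \subset V :\: W0, A j \subset W & P (A j)]
      & forall i j, i < N -> j < N -> i != j -> [disjoint A i & A j]].
Proof.
move=> hP; elim: N => [|N IH] leN.
  by exists (fun=> W0), W0; split; rewrite // addn0.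
have [|A [W [cW W0W PA dA]]] := IH; first by rewrite mulSn in leN; lia.
have [|X [XV cX PX]] := hP W; first by rewrite mulSn in leN; lia.
have XW : [disjoint X & W].
  by apply/pred0P => z /=; apply/andP => -[/(subsetP XV)]; rewrite inE => /andP[/negbTE ->].
have dX j : j < N -> [disjoint X & A j].
  by move=> /PA[_ AW _]; apply: disjointWr AW XW.
exists (fun j => if j == N then X else A j), (W :|: X); split.
- by have := cardsUI W X; rewrite mulSn; lia.
- exact: subset_trans W0W (subsetUl _ _).
- move=> j; rewrite ltnS leq_eqVlt; case: eqVneq => [_ _|_ /= /PA[AV AW PAj]].
    split=> //; last exact: subsetUr.
    by apply: subset_trans XV _; apply: setDS.
  by split=> //; apply: subset_trans AW (subsetUl _ _).
- move=> i j; rewrite !ltnS (leq_eqVlt i) (leq_eqVlt j).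
  case: eqVneq => [->|_]; case: eqVneq => [->|_] //=; rewrite ?eqxx //.
  + by move=> _ jN _; apply: dX.
  + by move=> iN _ _; rewrite disjoint_sym; apply: dX.
  + exact: dA.
Qed.

(* Among [2 * t] disjoint connected sets of size at most [2 * a + 1], each
   missing few vertices, every one of the [s] sets of size at most [2 * b + 1]
   fails to meet the neighbourhood of a proportion at most [1 / (2 * s)], so
   that [t] of the [2 * t] sets are adjacent to all [s] sets. *)
Lemma dense_has_Kst V r s t a b : symmetric r -> 0 < #|V| ->
    2 * s <= 2 ^ (a.+1 * b.+1) ->
    {in V, forall y, 2 * #|misses V r y| +
       (t.*2 * a.*2.+1 + s * b.*2.+1) <= #|V|} ->
  has_model (Kst s t) V r.
Proof.
move=> rS V0 sab; set w := _ + _ => hV.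
(* [m] is half of [#|V| - w], rounded down. As subtraction truncates, a vertex of [V] is used to
   obtain [w <= #|V|]. *)
have [m [rm mw]] : exists m, {in V, forall y, #|misses V r y| <= m} /\ m.*2 + w <= #|V|.
  exists (#|V| - w)./2; split.
    by move=> y /hV le; rewrite geq_half_double; lia.
  have /card_gt0P[y /hV] := V0.
  by have := odd_double_half (#|V| - w); lia.
have cD W : #|V| <= #|V :\: W| + #|W|.
  by rewrite -(cardsID W V) addnC leq_add2l subset_leq_card ?subsetIr.
pose conn X := exists2 x0, x0 \in X & {in X, forall x, connect (within r X) x0 x}.
pose PA X := conn X /\ #|unhit r V X| * 2 ^ a <= m.
have [||A [WA [cWA _ hA dA]]] := @disjoint_packing V PA a.*2.+1 t.*2 finset.set0 w.
- move=> W cW; have Wm : #|W| + m.*2 < #|V| by lia.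
  have /card_gt0P[v0 v0U] : 0 < #|V :\: W| by have := cD W; lia.
  have [|X [v0X XU cX conX hX]] := @grow_hitting T r V V r W m 2 v0 a rS rm Wm v0U.
    move=> u uV; apply: (@leq_trans m.*2); last by have := cD W; lia.
    rewrite -mul2n leq_mul2l /=; apply: leq_trans (rm u uV); apply: subset_leq_card.
    by apply/subsetP => z; rewrite !inE rS => /andP[/andP[_ ->]].
  exists X; split => //; split; first by exists v0.
  apply: leq_trans hX _; have v0V : v0 \in V by move: v0U; rewrite inE => /andP[].
  apply: leq_trans (rm v0 v0V); apply: subset_leq_card; apply/subsetP => z.
  by rewrite !inE => /andP[-> /forall_inP /(_ v0)]; rewrite inE eqxx => ->.
- by rewrite cards0 /w; lia.
pose hit (u : T) (j : 'I_t.*2) := [exists v in A j, r v u].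
(* One factor [2 ^ a.+1] comes from the choice of the root, the other [b] from the growth rounds. *)
pose PB X := conn X /\ #|unhit hit [set: 'I_t.*2]%SET X| * 2 ^ (a.+1 * b.+1) <= t.*2.
have [||B [WB [cWB _ hB dB]]] := @disjoint_packing V PB b.*2.+1 s WA w.
- move=> W cW; have Wm : #|W| + m.*2 < #|V| by lia.
  have U0 : 0 < #|V :\: W| by have := cD W; lia.
  (* At most [m / 2 ^ a] vertices have no neighbour in [A j], and [2 * m] is at most the number of
     free vertices. *)
  have hitW : {in [set: 'I_t.*2]%SET, forall j,
      2 ^ a.+1 * #|[set u in V :\: W | ~~ hit u j]%SET| <= #|V :\: W|}.
    move=> j _; have [_ _ [_ Aj]] := hA j (ltn_ord j).
    apply: (@leq_trans m.*2); last by have := cD W; lia.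
    rewrite expnS -mulnA -mul2n leq_mul2l /= mulnC; apply: leq_trans Aj.
    rewrite leq_mul2r; apply/orP; right; apply: subset_leq_card.
    apply/subsetP => z; rewrite !inE => /andP[/andP[_ ->]] /= /exists_inPn hz.
    by apply/forall_inP => u /hz.
  have [v0 v0U hv0] := exists_hitting U0 hitW.
  have [X [v0X XU cX conX hX]] :=
    @grow_hitting _ hit [set: 'I_t.*2]%SET V r W m (2 ^ a.+1) v0 b rS rm Wm v0U hitW.
  exists X; split => //; split; first by exists v0.
  rewrite expnM expnSr mulnA.
  apply: leq_trans (leq_mul hX (leqnn _)) _; rewrite cardsT card_ord in hv0.
  apply: leq_trans hv0; rewrite mulnC leq_mul2l; apply/orP; right.
  apply: subset_leq_card; apply/subsetP => z.
  by rewrite !inE => /forall_inP /(_ v0); rewrite inE eqxx => ->.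
- by rewrite cards0 in cWA; rewrite /w; lia.
(* Each of the [s] sets misses at most [2 * t / 2 ^ (a.+1 * b.+1)] targets, which is at most
   [t / s]; so at least [t] targets are hit by all. *)
pose bad := (\bigcup_(i < s) unhit hit [set: 'I_t.*2]%SET (B i))%SET.
have badt : #|bad| <= t.
  have le1 : #|bad| <= \sum_(i < s) #|unhit hit [set: 'I_t.*2]%SET (B i)|.
    by rewrite /bad; elim/big_rec2: _ => [|i n Y _ le]; rewrite ?cards0 //;
       apply: leq_trans (leq_card_setU _ _) _; rewrite leq_add2l.
  rewrite -(@leq_pmul2r (2 ^ (a.+1 * b.+1))) ?expn_gt0 //.
  apply: leq_trans (leq_mul le1 (leqnn _)) _.
  rewrite big_distrl /=; apply: (@leq_trans (\sum_(i < s) t.*2)).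
    by apply: leq_sum => i _; have [_ _ []] := hB i (ltn_ord i).
  by rewrite sum_nat_const card_ord; nia.
have goodt : t <= #|~: bad| by have := cardsC bad; rewrite card_ord; lia.
pose g (j : 'I_t) : 'I_t.*2 := enum_val (widen_ord goodt j).
have gI : injective g.
  by move=> i j /enum_val_inj /(congr1 val) /= /val_inj.
have gbad j : g j \notin bad.
  by have := enum_valP (widen_ord goodt j); rewrite inE.
pose X (z : Kst s t) := match z with inl i => B i | inr j => A (g j) end.
have XP z : X z \subset V /\ conn (X z).
  case: z => [i|j] /=.
    by have [BV _ [cB _]] := hB i (ltn_ord i); split=> //; apply: subset_trans BV (subsetDl _ _).
  by have [AV _ [cA _]] := hA (g j) (ltn_ord _); split=> //; apply: subset_trans AV (subsetDl _ _).
have dAB i j : [disjoint B i & A (g j)] \/ ~~ (i < s).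
  case: (ltnP i s) => [ltis|_]; [left|by right].
  have [BV _ _] := hB i ltis; have [_ AW _] := hA (g j) (ltn_ord _).
  apply/pred0P => z /=; apply/andP => -[/(subsetP BV)].
  by rewrite inE => /andP[/negP zW _] /(subsetP AW).
have edgeX (i : 'I_s) (j : 'I_t) : exists x y, [/\ x \in B i, y \in A (g j) & r x y].
  have : g j \notin unhit hit [set: 'I_t.*2]%SET (B i).
    by apply: contra (gbad j); apply/subsetP; apply: (bigcup_sup i).
  rewrite !inE /= => /forall_inPn[u uB]; rewrite negbK => /exists_inP[v vA rvu].
  by exists u, v; rewrite rS.
apply: (@has_model_sets T (Kst s t) V r X).
- by move=> z; have [] := XP z.
- by move=> z; have [_ [x0 x0X _]] := XP z; apply/card_gt0P; exists x0.
- case=> [i|j] [i'|j'] /= ne.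
  + exact: dB (ltn_ord _) (ltn_ord _) ne.
  + by case: (dAB i j') => //; rewrite ltn_ord.
  + by rewrite disjoint_sym; case: (dAB i' j) => //; rewrite ltn_ord.
  + apply: dA (ltn_ord _) (ltn_ord _) _.
    by apply: contra ne => /eqP /val_inj /gI ->.
- move=> z x y xX yX; have [_ [x0 x0X cX]] := XP z.
  apply: (@connect_trans _ _ x0); last exact: cX.
  by rewrite (sym_connect_sym (within_sym _ rS)); apply: cX.
- case=> [i|j] [i'|j']; rewrite /edge //= => _.
  by have [x [y [xB yA rxy]]] := edgeX i' j; exists y, x; rewrite rS.
Qed.

End Dense.

(** * From branch sets to contractions *)

Section ModelMinor.
Variable H : sgraph.

Lemma connect_morph (T T' : finType) (e : rel T) (e' : rel T') (f : T -> T') :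
  (forall a b, e a b -> connect e' (f a) (f b)) ->
  forall a b, connect e a b -> connect e' (f a) (f b).
Proof.
move=> hf a b /connectP[p pe ->]; elim: p a pe => [|c p IH] a /=.
  by move=> _; apply: connect0.
by case/andP => /hf ac /IH; apply: connect_trans.
Qed.

(** Induction on the number of vertices: an injective [phi] is an isomorphism; otherwise some
    connected fiber contains an edge, and [phi] descends to its contraction. *)
Lemma contracts_to_fibers (G : sgraph) (phi : G -> H) :
    (forall h, exists x, phi x = h) ->
    (forall x y, phi x = phi y ->
       connect (fun a b => (phi a == phi b) && edge a b) x y) ->
    (forall x y, edge x y -> phi x != phi y -> edge (phi x) (phi y)) ->
    (forall h k : H, edge h k -> exists x y, [/\ phi x = h, phi y = k & edge x y]) ->
  exists2 K, contracts_to G K & isomorphic K H.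
Proof.
have [n] := ubnP #|G|; elim: n G phi => // n IH G phi leG pS pC pE pL.
have [/injectiveP inj|/injectivePn[x [y xy pxy]]] := boolP (injectiveb phi).
  exists G; first exact: contracts_refl.
  exists phi.
    have sur h : exists x, phi x == h by have [x <-] := pS h; exists x.
    exists (fun h => xchoose (sur h)) => [x|h]; last exact/eqP/(xchooseP (sur h)).
    by apply: inj; apply/eqP/(xchooseP (sur (phi x))).
  move=> x y; apply/idP/idP => [/pL[x' [y' [/inj-> /inj-> //]]]|exy].
  apply: pE => //; apply: contraTneq exy => /inj ->.
  by rewrite edge_irrefl.
have [z [xz exz pxz]] : exists z, [/\ z != x, edge x z & phi z = phi x].
  have /connectP[[|z p] /=] := pC x y pxy; first by move=> _ yx; rewrite yx eqxx in xy.
  case/andP => /andP[/eqP pxz exz] _ _; exists z; split=> //.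
  by apply: contraTneq exz => ->; rewrite edge_irrefl.
pose G' := Defs.contract x z.
have xz' : x != z by rewrite eq_sym.
(* The quotient map: the default value of [insubd] sends [z] to [x]. *)
pose f (a : G) : G' := insubd (Sub x xz' : G') a.
have fval (a : G') : f (val a) = a by rewrite /f valKd.
have fz : f z = Sub x xz' by rewrite /f /insubd insubF // eqxx.
have fE a : a != z -> val (f a) = a by move=> az; rewrite /f insubdK.
pose psi (a : G') : H := phi (val a).
have psif a : psi (f a) = phi a.
  by rewrite /psi; case: (eqVneq a z) => [->|/fE -> //]; rewrite fz pxz.
have fedge a b : edge a b -> f a != f b -> edge (f a) (f b).
  move=> eab fab; rewrite /edge /= /contract_edge fab /=.
  case: (eqVneq a z) => [az|az]; case: (eqVneq b z) => [bz|bz].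
  - by rewrite az bz edge_irrefl in eab.
  - by rewrite az fz /= fE // eqxx -az eab orbT.
  - by rewrite bz fz /= fE // eqxx -bz eab !orbT.
  - by rewrite !fE // eab.
have [|||||K cK iK] := IH G' psi.
- move: leG; rewrite ltnS; apply: leq_trans.
  have -> : #|G'| = #|predC1 z| := card_sig (predC1 z).
  by rewrite cardC1 ltn_predL; apply/card_gt0P; exists z.
- by move=> h; have [a <-] := pS h; exists (f a).
- move=> a b pab; rewrite -(fval a) -(fval b).
  apply: connect_morph (pC _ _ pab) => c d /andP[pcd ecd].
  case: (eqVneq (f c) (f d)) => [->|fcd]; first exact: connect0.
  by apply: connect1; rewrite !psif pcd fedge.
- move=> a b; rewrite {1}/edge /= => /andP[_].
  case/or3P => [eab|/andP[/eqP ax eab]|/andP[/eqP bx eab]]; rewrite /psi.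
  + exact: pE.
  + by rewrite ax -pxz; apply: pE.
  + by rewrite bx -pxz; apply: pE.
- move=> h k ehk; have [a [b [pa pb eab]]] := pL h k ehk.
  exists (f a), (f b); rewrite !psif; split => //; apply: fedge => //.
  apply: contraTneq ehk => /(congr1 psi); rewrite !psif pa pb => ->.
  by rewrite edge_irrefl.
by exists K => //; apply: contracts_step cK.
Qed.

(** The subgraph keeps the vertices of the branch sets, and only those edges that lie inside one of
    them or join the branch sets of two adjacent vertices of [H]. *)
Lemma has_model_minor (G : sgraph) (V : {set G}) :
  has_model H V (@edge G) -> minor H G.
Proof.
case=> phi [_ pS pC pE].
pose D := {z : G | phi z}.
have someD (a : D) : {h | phi (val a) = Some h}.
  by case: a => z /=; case: (phi z) => // h _; exists h.
pose psi (a : D) : H := sval (someD a).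
have psiE (a : D) : phi (val a) = Some (psi a) by rewrite /psi; case: (someD a).
pose e : rel D := fun a b => edge (val a) (val b) &&
  ((psi a == psi b) || edge (psi a) (psi b)).
have eS : symmetric e.
  by move=> a b; rewrite /e (edge_sym (val a)) eq_sym (edge_sym (psi a)).
have eI : irreflexive e by move=> a; rewrite /e edge_irrefl.
have lift z h : phi z = Some h -> exists2 a : D, val a = z & psi a = h.
  move=> pz; have dz : phi z by rewrite pz.
  exists (exist _ z dz) => //.
  by have := psiE (exist _ z dz); rewrite /= pz => -[].
have [||||K cK iK] := @contracts_to_fibers (SGraph eS eI) psi.
- by move=> h; have [z pz] := pS h; have [a _ pa] := lift z h pz; exists a.
- move=> a b pab; have := pC (psi a) (val a) (val b) (psiE a).
  rewrite {1}pab => /(_ (psiE b)).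
  pose f z : D := insubd a z.
  have fv (c : D) : f (val c) = c by rewrite /f valKd.
  move=> /(@connect_morph _ _ _ (fun c d : SGraph eS eI => (psi c == psi d) && edge c d) f).
  rewrite !fv; apply=> c d /and3P[/eqP pc /eqP pd ecd]; apply: connect1.
  have [c' vc pc'] := lift _ _ pc; have [d' vd pd'] := lift _ _ pd.
  by rewrite -vc -vd !fv /edge /= /e pc' pd' eqxx vc vd ecd.
- by move=> a b; rewrite {1}/edge /= /e => /andP[_ /orP[/eqP ->|//]]; rewrite eqxx.
- move=> h k ehk; have [x [y [px py exy]]] := pE h k ehk.
  have [a va pa] := lift _ _ px; have [b vb pb] := lift _ _ py.
  by exists a, b; rewrite pa pb /edge /= /e va vb exy pa pb ehk orbT.
exists (SGraph eS eI), K; split => //.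
exists (val : D -> G); first exact: val_inj.
by move=> a b /andP[].
Qed.

End ModelMinor.

(** * Contraction-minimal graphs *)

Section Extremal.
Variables (R : realType) (H : sgraph) (T : finType) (F : nat -> R).
Implicit Types (V X : {set T}) (r : rel T).
Local Open Scope ring_scope.

(** Deleting a vertex, deleting an edge or contracting an edge each fails to leave [degsum] above
    [F], rewritten in terms of the original [degsum]. *)
Definition contraction_minimal V r :=
  {in V, forall y, (degsum V r)%:R <= F #|V|.-1 + 2 * #|nbhd V r y|%:R} /\
  {in V &, forall x y, r x y -> (degsum V r)%:R <= F #|V| + 2 /\
    (degsum V r)%:R <= F #|V|.-1 + 2 + 2 * #|nbhd V r x :&: nbhd V r y|%:R}.

(** Every admissible reduction lowers [#|V| + degsum V r], the induction measure. *)
Lemma exists_contraction_minimal V r : symmetric r -> irreflexive r ->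
  F #|V| < (degsum V r)%:R ->
  exists V' r', [/\ symmetric r', irreflexive r',
    (#|V'| <= #|V|)%N /\ F #|V'| < (degsum V' r')%:R,
    has_model H V' r' -> has_model H V r & contraction_minimal V' r'].
Proof.
have [n] := ubnP (#|V| + degsum V r)%N; elim: n V r => // n IH V r len rS rI FV.
have recurse V1 r1 : symmetric r1 -> irreflexive r1 ->
    F #|V1| < (degsum V1 r1)%:R -> (#|V1| <= #|V|)%N ->
    (#|V1| + degsum V1 r1 < #|V| + degsum V r)%N ->
    (has_model H V1 r1 -> has_model H V r) ->
  exists V' r', [/\ symmetric r', irreflexive r',
    (#|V'| <= #|V|)%N /\ F #|V'| < (degsum V' r')%:R,
    has_model H V' r' -> has_model H V r & contraction_minimal V' r'].
  move=> r1S r1I F1 V1V lt1 m1.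
  have [|V' [r' [r'S r'I [V'V1 F'] m' min']]] := IH V1 r1 _ r1S r1I F1; first lia.
  exists V', r'; split => //; first by split=> //; apply: leq_trans V1V.
  by move=> h; apply/m1/m'.
have cD y : y \in V -> #|V :\ y| = #|V|.-1.
  by move=> yV; rewrite (cardsD1 y V) yV.
have cV y : y \in V -> (0 < #|V|)%N by move=> yV; apply/card_gt0P; exists y.
case: (boolP [exists y in V, F #|V|.-1 + 2 * #|nbhd V r y|%:R < (degsum V r)%:R]).
  case/exists_inP => y yV lt; have e := degsum_del rS rI yV.
  apply: (recurse (V :\ y) r) => //.
  - move: lt; rewrite e natrD -muln2 natrM cD // => lt; lra.
  - by rewrite cD // leq_pred.
  - by rewrite cD //; have := cV y yV; lia.
  - by apply: has_model_sub; rewrite ?subsetDl.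
move=> /exists_inPn minV.
case: (boolP [exists x in V, [exists y in V, r x y &&
    ((F #|V| + 2 < (degsum V r)%:R) || (F #|V|.-1 + 2 +
     2 * #|nbhd V r x :&: nbhd V r y|%:R < (degsum V r)%:R))]]).
  case/exists_inP => x xV /exists_inP[y yV /andP[rxy /orP[lt|lt]]].
  - have e := degsum_del_edge rS rI xV yV rxy.
    apply: (recurse V (del r x y)) => //.
    + exact: del_sym.
    + exact: del_irr.
    + by move: lt; rewrite e natrD => lt; lra.
    + lia.
    + by apply: has_model_sub => // a b /andP[].
  - have e := degsum_contr rS rI xV yV rxy.
    apply: (recurse (V :\ y) (contr r x y)) => //.
    + exact: contr_sym.
    + exact: contr_irr.
    + by move: lt; rewrite e !natrD -muln2 natrM cD // => lt; lra.
    + by rewrite cD // leq_pred.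
    + by rewrite cD //; have := cV y yV; lia.
    + exact: has_model_contr.
move=> /exists_inPn minE; exists V, r; split => //; split => [y yV|x y xV yV rxy].
  by rewrite leNgt minV.
have := minE x xV => /exists_inPn /(_ y yV).
by rewrite rxy /= negb_or -!leNgt => /andP[].
Qed.

(* The new vertex set is the neighbourhood of a vertex [x] of minimum degree in
   a contraction-minimal graph: the degree of [y] in it is the number of
   triangles containing the edge [xy]. *)
Lemma exists_dense_neighbourhood V r : symmetric r -> irreflexive r ->
    F #|V| < (degsum V r)%:R ->
    (forall n e, (e <= n * n.-1)%N -> F n < e%:R -> 0 <= F n /\ F n.-1 <= F n) ->
  exists V' r' n e, [/\ symmetric r', irreflexive r' /\ (0 < #|V'|)%N,
    has_model H V' r' -> has_model H V r,
    [/\ (n <= #|V|)%N, (e <= n * n.-1)%N, F n < e%:R & #|V'|%:R * n%:R <= F n + 2]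
    & {in V', forall y, F n < F n.-1 + 2 + 2 * #|nbhd V' r' y|%:R}].
Proof.
move=> rS rI FV hF.
have [V' [r' [r'S r'I [V'V FV'] m' [minV minE]]]] := exists_contraction_minimal rS rI FV.
have eV' := degsum_le V' r'I; have [F0 Fmono] := hF _ _ eV' FV'.
have V'0 : (0 < #|V'|)%N.
  rewrite lt0n; apply/eqP => V'0; rewrite V'0 mul0n leqn0 in eV'.
  by move: FV'; rewrite (eqP eV') ltNge F0.
have [x xV xmin] := exists_min_deg r' V'0.
(* An isolated [x] could be deleted, since [F] at [#|V'|.-1] is at most [F] at [#|V'|]. *)
have dx : (0 < #|nbhd V' r' x|)%N.
  rewrite lt0n; apply/eqP => d0; have := minV x xV.
  rewrite d0 mulr0 addr0 => le; have := le_lt_trans le (le_lt_trans Fmono FV').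
  by rewrite ltxx.
exists (nbhd V' r' x), r', #|V'|, (degsum V' r'); split => //.
- by move/(has_model_sub _ (fun _ _ h => h)) => h; apply/m'/h/subsetP => u; rewrite inE => /andP[].
(* As there is an edge at [x], minimality under edge deletion bounds [degsum] by [F n + 2]. *)
- have /card_gt0P[y] := dx; rewrite inE => /andP[yV rxy]; split => //.
  have [le _] := minE x y xV yV rxy.
  by apply: le_trans le; rewrite -natrM ler_nat.
- move=> y; rewrite inE => /andP[yV rxy]; have [_] := minE x y xV yV rxy.
  have -> : nbhd V' r' x :&: nbhd V' r' y = nbhd (nbhd V' r' x) r' y.
    by apply/setP => u; rewrite !inE; case: (u \in V'); rewrite ?andbF.
  exact: lt_le_trans.
Qed.

End Extremal.

(** * Numerical estimates for the logarithm *)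

Section Logarithm.
Variable R : realType.
Local Open Scope ring_scope.

(** Cubing [exp (- 1 / 5) >= 4 / 5] gives [exp (3 / 5) <= 125 / 64 < 2]. *)
Lemma ln2_ge : 3 / 5 <= ln (2 : R).
Proof.
rewrite -ler_expR lnK ?posrE //.
have h : 4 / 5 <= expR (- (1 / 5)) :> R by have := expR_ge1Dx (- (1 / 5) : R); lra.
have e1 : expR (3 / 5) * expR (- (1 / 5)) ^+ 3 = 1 :> R.
  rewrite -expRM_natl -expRD (_ : 3 / 5 + _ = 0 :> R) ?expR0 //.
  by lra.
have h3 : (4 / 5) ^+ 3 <= expR (- (1 / 5)) ^+ 3 :> R by rewrite lerXn2r ?nnegrE //; lra.
have := expR_gt0 (3 / 5 : R); nra.
Qed.

(** [exp (5 / 2)] is the tenth power of [exp (1 / 4) >= 5 / 4], and [(5 / 4) ^ 10 > 8]. *)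
Lemma ln8_le : ln (8 : R) <= 5 / 2.
Proof.
rewrite -ler_expR lnK ?posrE //.
have -> : 5 / 2 = 10%:R * (1 / 4) :> R by lra.
rewrite expRM_natl.
have h : 5 / 4 <= expR (1 / 4) :> R by have := expR_ge1Dx (1 / 4 : R); lra.
apply: (@le_trans _ _ ((5 / 4) ^+ 10)); last by rewrite lerXn2r ?nnegrE //; lra.
by rewrite !exprS expr0; lra.
Qed.

(* [n * (1 + ln (n / k))] is Mader's potential: its increments exceed its
   mean value by almost one. *)
Lemma mader_increment (k x : R) : 1 <= k -> k <= x - 1 ->
  2 + ln (x / k) - 1 / x <= x * (1 + ln (x / k)) - (x - 1) * (1 + ln ((x - 1) / k)).
Proof.
move=> k1 kx; have x0 : 0 < x by lra.
have y0 : 0 < (x - 1) / k by rewrite divr_gt0; lra.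
have h : ln ((x - 1) / x) <= - (1 / x).
  have -> : (x - 1) / x = 1 + - (1 / x) by field; lra.
  by apply: le_ln1Dx; rewrite ltrN2 ltr_pdivrMr; lra.
have -> : (x - 1) / k = (x / k) * ((x - 1) / x) by field; apply/andP; split; lra.
rewrite [ln (x / k * _)]lnM ?posrE; try by rewrite divr_gt0; lra.
have h1 : (x - 1) * ln ((x - 1) / x) <= (x - 1) * (- (1 / x)) by rewrite ler_pM2l; lra.
have h2 : (x - 1) * (- (1 / x)) = 1 / x - 1 by field; lra.
rewrite h2 in h1; move: (ln _) (ln _) h1 => A B h1; nra.
Qed.

End Logarithm.

(** * Choice of the parameters *)

Section BranchSizes.
Variable R : realType.
Local Open Scope ring_scope.

(* The sizes balance the two summands: up to rounding, both are equal to
   [(21 / 4) * sqrt (s * t * ln s)], and the product of the sizes is large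
   enough compared with [ln s]. *)
Lemma exists_branch_sizes s t : (2 <= s)%N -> (s <= t)%N ->
  exists a b, (2 * s <= 2 ^ (a.+1 * b.+1))%N /\
   (t.*2 * a.*2.+1 + s * b.*2.+1)%:R <=
     21 / 2 * Num.sqrt (s%:R * t%:R * ln (s%:R : R)) + 2 * t%:R + s%:R.
Proof.
move=> s2 st; set S := Num.sqrt _.
have sR : 2 <= s%:R :> R by rewrite ler_nat.
have tR : 2 <= t%:R :> R by rewrite ler_nat; lia.
have ln2 := ln2_ge R.
have l0 : ln 2 <= ln (s%:R : R) by rewrite ler_ln ?posrE //; lra.
have S0 : 0 <= S by apply: sqrtr_ge0.
have S2 : S ^+ 2 = s%:R * t%:R * ln s%:R by rewrite sqr_sqrtr // !mulr_ge0 //; lra.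
(* Chosen so that [4 * t * a0 = 2 * s * b0 = 21 / 4 * S]. *)
pose a0 := 21 / 16 * S / t%:R; pose b0 := 21 / 8 * S / s%:R.
have a00 : 0 <= a0 by rewrite divr_ge0 ?mulr_ge0 //; lra.
have b00 : 0 <= b0 by rewrite divr_ge0 ?mulr_ge0 //; lra.
exists (Num.truncn a0), (Num.truncn b0).
have ale : (Num.truncn a0)%:R <= a0 by rewrite truncn_le.
have ble : (Num.truncn b0)%:R <= b0 by rewrite truncn_le.
have alt : a0 < (Num.truncn a0).+1%:R by apply: truncnS_gt.
have blt : b0 < (Num.truncn b0).+1%:R by apply: truncnS_gt.
move: (Num.truncn a0) (Num.truncn b0) ale ble alt blt => a b ale ble alt blt.
split; last first.
  have ta : t%:R * a%:R <= 21 / 16 * S.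
    have -> : 21 / 16 * S = t%:R * a0 by rewrite /a0; field; lra.
    by rewrite ler_pM2l //; lra.
  have sb : s%:R * b%:R <= 21 / 8 * S.
    have -> : 21 / 8 * S = s%:R * b0 by rewrite /b0; field; lra.
    by rewrite ler_pM2l //; lra.
  have -> : (t.*2 * a.*2.+1 + s * b.*2.+1)%:R =
      4 * (t%:R * a%:R) + 2 * (s%:R * b%:R) + 2 * t%:R + s%:R :> R.
    by rewrite -!mul2n natrD !natrM -[(2 * a).+1]addn1 -[(2 * b).+1]addn1 !natrD ?natrM; ring.
  by lra.
(* After taking logarithms, [a0 * b0 = 441 / 128 * ln s >= 10 / 3 * ln s], and the factor
   [ln 2 >= 3 / 5] leaves the required [2 * ln s]. *)
apply: (@leq_trans (s ^ 2)%N); first by rewrite expnS expn1 leq_mul2r s2 orbT.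
rewrite -(ler_nat R) !natrX -ler_ln ?posrE ?exprn_gt0 //; try lra.
rewrite !lnXn //; try lra.
rewrite -(mulr_natl (ln s%:R)) -(mulr_natl (ln 2)) natrM.
have ab : a0 * b0 <= a.+1%:R * b.+1%:R by rewrite ler_pM // ltW.
have e : a0 * b0 = 441 / 128 * ln s%:R.
  have -> : a0 * b0 = 441 / 128 * (S ^+ 2 / (s%:R * t%:R)).
    by rewrite /a0 /b0; field; apply/andP; split; lra.
  by rewrite S2; field; apply/andP; split; lra.
have ls0 : 0 <= ln (s%:R : R) by lra.
have {}ab : 10 / 3 * ln (s%:R : R) <= a.+1%:R * b.+1%:R.
  by apply: le_trans ab; rewrite e ler_wpM2r //; lra.
have : 10 / 3 * ln s%:R * (3 / 5) <= a.+1%:R * b.+1%:R * ln (2 : R).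
  by apply: ler_pM => //; rewrite mulr_ge0.
by lra.
Qed.

End BranchSizes.

(** Each edge arises from the two distinct ordered pairs [(x, y)] and [(y, x)]. *)
Lemma edges_le_degsum (G : sgraph) :
  2 * #|edges G| <= degsum [set: G]%SET (@edge G).
Proof.
set D := [set p : G * G | edge p.1 p.2]%SET; pose f (p : G * G) := [set p.1; p.2]%SET.
have -> : degsum [set: G]%SET (@edge G) = \sum_(p in D) 1.
  rewrite /degsum; under eq_bigr => x _ do rewrite -sum1_card.
  by rewrite pair_big_dep; apply: eq_bigl => p; rewrite !inE.
rewrite (partition_big_imset f) /= mulnC -sum_nat_const.
apply: leq_sum => E /imsetP[[x y]]; rewrite inE /= => exy ->.
have xy : x != y by apply: contraTneq exy => ->; rewrite edge_irrefl.
rewrite (bigD1 (x, y)) /=; last by rewrite inE /= exy eqxx.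
rewrite (bigD1 (y, x)) //= inE /= edge_sym exy /f /= setUC eqxx /=.
by rewrite xpair_eqE negb_and eq_sym xy.
Qed.

Local Open Scope ring_scope.

(** * Mader's superlinear potential *)

Section MaderPotential.
Variables (R : realType) (k : R).

(* The value below [k] only makes sure that no graph on fewer than [k]
   vertices exceeds the potential. *)
Definition mader (n : nat) : R :=
  if n%:R < k then n%:R ^+ 2 else k * (n%:R * (1 + ln (n%:R / k))).

Lemma ln_ratio_ge0 x : 1 <= k -> k <= x -> 0 <= ln (x / k).
Proof. by move=> k1 kx; rewrite ln_ge0 // ler_pdivlMr ?mul1r; lra. Qed.

(** Below [k] the potential [n ^ 2] already exceeds [n * (n - 1)]; from [k] on it is at least
    [k * n], so [k * n < n * (n - 1)]. *)
Lemma mader_exceeded n e : 1 <= k -> (e <= n * n.-1)%N -> mader n < e%:R -> k < n.-1%:R.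
Proof.
rewrite -(ler_nat R) natrM /mader => k1 en; case: n en => [|n] /= en.
  rewrite mul0r in en; have -> : (0 : R) < k by lra.
  by rewrite expr0n /=; lra.
rewrite -!natr1 in en *; have n0 : 0 <= n%:R :> R by [].
case: (ltP _ k) => [_|kn] lt; first by rewrite expr2 in lt; nra.
have L0 := ln_ratio_ge0 k1 kn; rewrite -(ltr_pM2r (_ : 0 < n%:R + 1)); last lra.
apply: (le_lt_trans _ (lt_le_trans lt _)); last by rewrite mulrC.
by rewrite ler_pM2l ?ler_peMr //; lra.
Qed.

Lemma mader_increase n : 1 <= k -> k <= n.-1%:R ->
  k * (2 + ln (n%:R / k) - 1 / n%:R) <= mader n - mader n.-1.
Proof.
move=> k1 kn; have n0 : (0 < n)%N by case: n kn => //=; lra.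
have e : n.-1%:R = n%:R - 1 :> R by rewrite -[in RHS](prednK n0) -natr1 addrK.
rewrite /mader !ltNge kn (_ : k <= n%:R) /=; last by rewrite e in kn; lra.
by rewrite e -mulrBr ler_pM2l; [apply: mader_increment; lra|lra].
Qed.

(** This is the regularity condition on [F] under which a dense neighbourhood is extracted. *)
Lemma mader_regular n e : 1 <= k -> (e <= n * n.-1)%N -> mader n < e%:R ->
  0 <= mader n /\ mader n.-1 <= mader n.
Proof.
move=> k1 en lt; have kn := mader_exceeded k1 en lt.
have n0 : (0 < n)%N by case: n kn {en lt} => //=; lra.
have n1 : 1 <= n%:R :> R by rewrite ler1n.
have e1 : n.-1%:R = n%:R - 1 :> R by rewrite -[in RHS](prednK n0) -natr1 addrK.
have knn : k <= n%:R by lra.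
have L0 := ln_ratio_ge0 k1 knn; split.
  by rewrite /mader ltNge knn /= !mulr_ge0 //; lra.
rewrite -subr_ge0; apply: le_trans (mader_increase k1 (ltW kn)).
rewrite mulr_ge0 //; first lra.
have : 1 / n%:R <= 1 :> R by rewrite ler_pdivrMr; lra.
by lra.
Qed.

End MaderPotential.

(** * Two passes to a neighbourhood, then the greedy construction *)

Lemma dense_graph_minor (R : realType) (s t : nat) (G : sgraph) :
    (2 <= s)%N -> (s <= t)%N ->
    40 * (Num.sqrt (s%:R * t%:R * ln (s%:R : R)) + s%:R + t%:R) * #|G|%:R <
      #|edges G|%:R ->
  minor (Kst s t) G.
Proof.
move=> s2 st; have [a [b [ab]]] := exists_branch_sizes R s2 st.
set S := Num.sqrt _; set w := (_ + _)%N; move=> wS dG.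
have S0 : 0 <= S by apply: sqrtr_ge0.
have sR : 2 <= s%:R :> R by rewrite ler_nat.
have tR : 2 <= t%:R :> R by rewrite ler_nat; lia.
pose d := 40 * (S + s%:R + t%:R); pose k := 11 * (S + s%:R + t%:R).
rewrite -/d in dG.
have k44 : 44 <= k by rewrite /k; lra.
have k1 : 1 <= k by lra.
have dk : d = 40 / 11 * k by rewrite /d /k; lra.
have wk : w%:R <= k - 5 by rewrite /k; lra.
clearbody d k; clear S S0 wS.
(* First pass: a linear potential, with the factor 2 because [degsum] counts each edge twice. *)
pose F1 (n : nat) : R := 2 * d * n%:R.
have [||V1 [r1 [n1 [e1 [r1S [r1I V10] m1 [_ en1 Fe1 d1] c1]]]]] :=
  @exists_dense_neighbourhood R (Kst s t) G F1 [set: G]%SET (@edge G)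
    (@edge_sym G) (@edge_irrefl G).
- have := edges_le_degsum G; rewrite -(ler_nat R) natrM /F1 cardsT; lra.
- move=> n e _ _; rewrite /F1; split; first by rewrite !mulr_ge0 //; lra.
  by rewrite ler_pM2l ?ler_nat ?leq_pred //; lra.
have n10 : (0 < n1)%N.
  rewrite lt0n; apply/eqP => n0; move: en1 Fe1; rewrite n0 leqn0 => /eqP ->.
  by rewrite /F1 mulr0 ltxx.
have n11 : 1 <= n1%:R :> R by rewrite ler1n.
have V1d : #|V1|%:R <= 2 * d + 2.
  rewrite -(ler_pM2r (_ : 0 < n1%:R)) ?ltr0n //.
  by apply: le_trans d1 _; rewrite /F1; lra.
have deg1 : {in V1, forall y, d - 1 < #|nbhd V1 r1 y|%:R}.
  move=> y /c1; rewrite /F1.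
  have -> : n1.-1%:R = n1%:R - 1 :> R by rewrite -[in RHS](prednK n10) -natr1 addrK.
  by lra.
have V1k : k <= #|V1|%:R.
  have /card_gt0P[y /deg1] := V10.
  have : #|nbhd V1 r1 y|%:R <= #|V1|%:R :> R.
    by rewrite ler_nat subset_leq_card //; apply/subsetP => u; rewrite inE => /andP[].
  by lra.
have sum1 : #|V1|%:R * (d - 1) < (degsum V1 r1)%:R.
  rewrite /degsum natr_sum mulrC mulr_natr -sumr_const.
  have /card_gt0P[y yV] := V10.
  rewrite (bigD1 y) // [ltRHS](bigD1 y) //=; apply: ltr_leD; first exact: deg1.
  by apply: ler_sum => z /andP[/deg1 /ltW].
have [||V2 [r2 [n [e [r2S [r2I V20] m2 [nV1 en Fe d2] c2]]]]] :=
  @exists_dense_neighbourhood R (Kst s t) G (mader k) V1 r1 r1S r1I.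
- apply: le_lt_trans sum1; rewrite /mader ltNge V1k /=.
  rewrite mulrCA ler_pM2l; last lra.
  (* From [#|V1| <= 2 * d + 2 <= 8 * k]. The potential is then at most [7 / 2 * k * #|V1|], and
     [7 / 2 * k <= d - 1] because [d = 40 / 11 * k] and [k >= 44]. *)
  have : ln (#|V1|%:R / k) <= 5 / 2.
    apply: le_trans (ln8_le R); rewrite ler_ln ?posrE ?divr_gt0 //; try lra.
    by rewrite ler_pdivrMr; lra.
  by move: (ln _) => L; nra.
- by move=> m i; apply: mader_regular.
have kn : k < n.-1%:R by apply: mader_exceeded Fe.
have n0 : (0 < n)%N by case: n kn {nV1 en Fe d2 c2} => //=; lra.
have enp : n.-1%:R = n%:R - 1 :> R by rewrite -[in RHS](prednK n0) -natr1 addrK.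
have knn : k <= n%:R by lra.
have inc := mader_increase k1 (ltW kn).
have {}inc : k * (2 + ln (n%:R / k)) - 1 <= mader k n - mader k n.-1.
  apply: le_trans inc.
  have : k * (1 / n%:R) <= 1 by rewrite mulrA mulr1 ler_pdivrMr; lra.
  by lra.
have V2n : #|V2|%:R <= k * (1 + ln (n%:R / k)) + 1.
  rewrite -(ler_pM2r (_ : 0 < n%:R)); last lra.
  apply: le_trans d2 _; rewrite /mader ltNge knn /=.
  by move: (ln _) => L; nra.
(* With [L = ln (n / k)], twice each degree exceeds [k * (2 + L) - 3], while
   [#|V2| <= k * (1 + L) + 1]. The terms in [L] cancel, and the surplus over [#|V2|] is more than
   [k - 4], hence more than [w]. *)
have hV2 : {in V2, forall y, (2 * #|misses V2 r2 y| + w <= #|V2|)%N}.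
  move=> y /c2 lt.
  have : (#|nbhd V2 r2 y| + #|misses V2 r2 y| = #|V2|)%N.
    rewrite -(cardsID [set u | r2 y u]%SET V2); congr (_ + _)%N; apply: eq_card => u.
      by rewrite !inE.
    by rewrite !inE andbC.
  move/(congr1 (fun m => m%:R : R)); rewrite natrD => eq.
  by rewrite -(ler_nat R) natrD natrM; lra.
apply: (@has_model_minor _ _ [set: G]%SET); apply/m1/m2.
exact: dense_has_Kst r2S V20 ab hV2.
Qed.

Theorem theorem1p10 (R : realType) (s t : nat) (hs : (2 <= s)%N) (hst : (s <= t)%N) :
  (extremal_density R (Kst s t) <=
     (40 * (Num.sqrt (s%:R * t%:R * ln (s%:R : R)) + s%:R + t%:R))%:E)%E.
Proof.
apply: ge_ereal_sup => _ [G [G0 noK ->]]; rewrite lee_fin leNgt; apply/negP => lt.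
apply: noK; apply: (@dense_graph_minor R) => //.
by rewrite -ltr_pdivlMr // ltr0n.
Qed.
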